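(* Let $K$ be a bounded right linear operator with closed range on a separable right quaternionic Hilbert space $\mathbb{H}(\mathfrak{H})$, with $\|K^{\dagger}\|=1$, where $K^{\dagger}$ is the pseudo-inverse of $K$. Let $F=\{f_k\}_{k\in I}$ be a $K$-frame for $\mathbb{H}(\mathfrak{H})$ and let $G=\{g_k\}_{k\in I}$ be an approximate $K$-dual of $\{f_k\}_{k\in I}$. Let $\Psi=P_{R(K)}T_FT_G^*K^{\dagger}$, regarded as an operator on $R(K)$. Then $\Psi$ is invertible on $R(K)$, and, with $\Psi^{-1}:R(K)\to R(K)$ its inverse: (a) $\{\Psi^{-1}P_{R(K)}f_k\}_{k\in I}$ is a $K$-frame for $\mathbb{H}(\mathfrak{H})$ with a $K$-dual $\{K^*(K^{\dagger})^*g_k\}_{k\in I}$. (b) $\{(K^{\dagger})^*g_k\}_{k\in I}$ is a $K$-frame for $\mathbb{H}(\mathfrak{H})$ with a $K$-dual $\{K^*\Psi^{-1}P_{R(K)}f_k\}_{k\in I}$.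
   Context: $\mathfrak{H}$ denotes the quaternions. A right quaternionic Hilbert space $\mathbb{H}(\mathfrak{H})$ is a right $\mathfrak{H}$-vector space with an inner product $\langle\cdot,\cdot\rangle$ valued in $\mathfrak{H}$ that satisfies $\overline{\langle x,y\rangle}=\langle y,x\rangle$, $\langle x,x\rangle>0$ for $x\neq0$, additivity in the second argument, and $\langle x,yq\rangle=\langle x,y\rangle q$ for $q\in\mathfrak{H}$, and it is complete for $\|x\|=\sqrt{\langle x,x\rangle}$. $I$ is a countable index set. $\ell^2(\mathfrak{H})$ is the right quaternionic Hilbert space of square-summable families $\{q_k\}_{k\in I}\subset\mathfrak{H}$ with $\langle p,q\rangle=\sum_{k}\overline{p_k}q_k$. All operators are bounded and right linear ($T(xp+yq)=T(x)p+T(y)q$), and $T^*$ is the adjoint. A family $\{f_k\}_{k\in I}\subset\mathbb{H}(\mathfrak{H})$ is a Bessel sequence if there is $B>0$ with $\sum_{k}|\langle x,f_k\rangle|^2\le B\|x\|^2$ for all $x$. It is a $K$-frame if there are $A,B>0$ with $A\|K^*x\|^2\le\sum_{k}|\langle x,f_k\rangle|^2\le B\|x\|^2$ for all $x$. A Bessel sequence $\{g_k\}_{k\in I}$ is a $K$-dual of a $K$-frame $\{f_k\}_{k\in I}$ if $Kx=\sum_{k\in I}f_k\langle g_k,x\rangle$ for all $x\in\mathbb{H}(\mathfrak{H})$. The synthesis operator of a Bessel sequence $F=\{f_k\}$ is $T_F:\ell^2(\mathfrak{H})\to\mathbb{H}(\mathfrak{H})$, $T_F(\{c_k\})=\sum_kf_kc_k$,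 with adjoint $T_F^*x=\{\langle f_k,x\rangle\}_{k}$. A Bessel sequence $G=\{g_k\}_{k\in I}$ is an approximate $K$-dual of a $K$-frame $F=\{f_k\}_{k\in I}$ if $\|K-T_FT_G^*\|<1$. $R(K)$ is the range of $K$, and $P_M$ is the orthogonal projection onto a closed subspace $M$. For $K$ with closed range, $K^{\dagger}$ denotes its pseudo-inverse: the operator equal to $(K|_{N(K)^{\perp}})^{-1}$ on $R(K)$ and to $0$ on $R(K)^{\perp}$, where $N(K)$ is the kernel of $K$. *)

(* Defs.v *)
From HB Require Import structures.
From mathcomp Require Import all_boot all_order all_algebra.
From mathcomp Require Import finmap ring.
From mathcomp Require Import all_classical all_reals.
From mathcomp Require Import ereal topology normedtype esum.
From mathcomp Require Import analysis.showcase.summability.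

Set Implicit Arguments.
Unset Strict Implicit.
Unset Printing Implicit Defensive.

Import Order.TTheory GRing.Theory Num.Theory.
Import numFieldNormedType.Exports.

Local Open Scope classical_set_scope.
Local Open Scope ring_scope.

(** * Quaternions *)

(* [Quat a b c d] is a + b i + c j + d k. *)
Record quat (R : Type) := Quat { qre : R; qi : R; qj : R; qk : R }.

Section QuatRing.
Variable R : realType.
Local Notation quat := (quat R).

Definition quat_tuple (q : quat) := (qre q, qi q, qj q, qk q).
Definition tuple_quat (t : R * R * R * R) : quat :=
  let: (a, b, c, d) := t in Quat a b c d.
Lemma quat_tupleK : cancel quat_tuple tuple_quat.
Proof. by case. Qed.

HB.instance Definition _ := Choice.copy quat (can_type quat_tupleK).

Definition qzero : quat := Quat 0 0 0 0.
Definition qone : quat := Quat 1 0 0 0.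
Definition qopp (p : quat) : quat :=
  Quat (- qre p) (- qi p) (- qj p) (- qk p).
Definition qadd (p q : quat) : quat :=
  Quat (qre p + qre q) (qi p + qi q) (qj p + qj q) (qk p + qk q).
Definition qmul (p q : quat) : quat :=
  Quat (qre p * qre q - qi p * qi q - qj p * qj q - qk p * qk q)
       (qre p * qi q + qi p * qre q + qj p * qk q - qk p * qj q)
       (qre p * qj q - qi p * qk q + qj p * qre q + qk p * qi q)
       (qre p * qk q + qi p * qj q - qj p * qi q + qk p * qre q).

Lemma qaddA : associative qadd.
Proof. by move=> p q r; rewrite /qadd /= !addrA. Qed.
Lemma qaddC : commutative qadd.
Proof.
by move=> p q; rewrite /qadd (addrC (qre p)) (addrC (qi p)) (addrC (qj p))
  (addrC (qk p)).
Qed.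
Lemma qadd0 : left_id qzero qadd.
Proof. by case=> a b c d; rewrite /qadd /= !add0r. Qed.
Lemma qaddN : left_inverse qzero qopp qadd.
Proof. by move=> p; rewrite /qadd /= !addNr. Qed.

HB.instance Definition _ := GRing.isZmodule.Build quat qaddA qaddC qadd0 qaddN.

Lemma qmulA : associative qmul.
Proof. by move=> p q r; rewrite /qmul /=; congr Quat; ring. Qed.
Lemma qmul1 : left_id qone qmul.
Proof. by case=> a b c d; rewrite /qmul /=; congr Quat; ring. Qed.
Lemma qmulr1 : right_id qone qmul.
Proof. by case=> a b c d; rewrite /qmul /=; congr Quat; ring. Qed.
Lemma qmulDl : left_distributive qmul +%R.
Proof.
by move=> p q r; rewrite /GRing.add /= /qmul /qadd /=; congr Quat; ring.
Qed.
Lemma qmulDr : right_distributive qmul +%R.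
Proof.
by move=> p q r; rewrite /GRing.add /= /qmul /qadd /=; congr Quat; ring.
Qed.
Lemma qone_neq0 : qone != 0.
Proof. by apply/eqP => -[/eqP]; rewrite oner_eq0. Qed.

HB.instance Definition _ := GRing.Zmodule_isNzRing.Build quat
  qmulA qmul1 qmulr1 qmulDl qmulDr qone_neq0.

Definition qreal (a : R) : quat := Quat a 0 0 0.
Definition qconj (q : quat) : quat := Quat (qre q) (- qi q) (- qj q) (- qk q).
Definition qnorm (q : quat) : R :=
  Num.sqrt (qre q ^+ 2 + qi q ^+ 2 + qj q ^+ 2 + qk q ^+ 2).

End QuatRing.

(** * Right quaternionic Hilbert spaces *)

(* A right quaternionic vector space is a real one, on which the quaternions act
   on the right, [rscale x q] being the vector x q; [rscale_real] identifies the
   library's scaling with the action of the real quaternions and gives x 1 = x.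
   [dotxx] says that the norm of V is sqrt <x, x>; with the norm axioms of V it
   contains the positivity of <x, x> for x != 0. *)
HB.mixin Record isQuatHilbert (R : realType) V & CompleteNormedModule R V := {
  rscale : V -> quat R -> V;
  rscaleDl : forall (x y : V) (q : quat R),
    rscale (x + y) q = rscale x q + rscale y q;
  rscaleDr : forall (x : V) (p q : quat R),
    rscale x (p + q) = rscale x p + rscale x q;
  rscaleA : forall (x : V) (p q : quat R),
    rscale x (p * q) = rscale (rscale x p) q;
  rscale_real : forall (x : V) (a : R), rscale x (qreal a) = a *: x;
  dot : V -> V -> quat R;
  dot_conj : forall x y : V, qconj (dot x y) = dot y x;
  dotDr : forall x y z : V, dot x (y + z) = dot x y + dot x z;
  dotZr : forall (x y : V) (q : quat R), dot x (rscale y q) = dot x y * q;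
  dotxx : forall x : V, dot x x = qreal (`|x| ^+ 2)
}.

#[short(type="quatHilbertType")]
HB.structure Definition QuatHilbert (R : realType) :=
  {V of CompleteNormedModule R V & isQuatHilbert R V}.

Definition separable_space (T : topologicalType) :=
  exists D : set T, countable D /\ dense D.

Section Operators.
Variables (R : realType) (H : quatHilbertType R).
Implicit Types (M : set H) (T S : H -> H) (x y : H).

Definition bounded_op T := exists C : R, forall x, `|T x| <= C * `|x|.

Definition opnorm T : \bar R :=
  ereal_sup [set `|T x|%:E | x in [set x | `|x| <= 1]].

Definition orth M : set H := [set x | forall m, M m -> dot m x = 0].

Definition kernel T : set H := [set x | T x = 0].

(* The objects selected by [xget] below are unique when they exist; they do
   exist in the situations where they are used (M a closed subspace, T bounded
   and right linear, with closed range for [pseudo_inverse]). *)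
Definition orth_proj M x : H := xget 0 [set m | M m /\ orth M (x - m)].

Definition adjoint T : H -> H :=
  xget (fun=> 0) [set S | forall x y, dot (T x) y = dot x (S y)].

Definition right_linear T := forall x y (p q : quat R),
  T (rscale x p + rscale y q) = rscale (T x) p + rscale (T y) q.

Definition pseudo_inverse T : H -> H :=
  xget (fun=> 0) [set S | [/\ right_linear S,
    forall x, orth (kernel T) x -> S (T x) = x
    & forall y, orth (range T) y -> S y = 0]].

(* T restricts to a bounded right linear operator on the subspace M *)
Definition operator_on M T :=
  [/\ forall x, M x -> M (T x),
      forall x y (p q : quat R), M x -> M y ->
        T (rscale x p + rscale y q) = rscale (T x) p + rscale (T y) q
    & exists C : R, forall x, M x -> `|T x| <= C * `|x|].

Definition inverse_on M T S :=
  operator_on M S /\ forall x, M x -> S (T x) = x /\ T (S x) = x.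

End Operators.

Section Frames.
Variables (R : realType) (H : quatHilbertType R) (I : countType).
Implicit Types (K : H -> H) (F G : I -> H) (x : H).

(* sum_k |<x, f_k>|^2 *)
Definition frame_sum F x : \bar R :=
  \esum_(k in [set: I]) (qnorm (dot x (F k)) ^+ 2)%:E.

Definition bessel F :=
  exists2 B : R, 0 < B & forall x, (frame_sum F x <= (B * `|x| ^+ 2)%:E)%E.

Definition is_Kframe K F := exists A B : R, [/\ 0 < A, 0 < B & forall x,
  ((A * `|adjoint K x| ^+ 2)%:E <= frame_sum F x <= (B * `|x| ^+ 2)%:E)%E].

(* Families indexed by I are summed unconditionally, along the finite subsets
   of I ordered by inclusion. *)
Definition has_sum (u : I -> H) (s : H) := partial_sum u @ totally --> s.

Definition is_Kdual K F G := bessel G /\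
  forall x, has_sum (fun k => rscale (F k) (dot (G k) x)) (K x).

(* T_F c = sum_k f_k c_k; meaningful for c square-summable and F Bessel *)
Definition synthesis F (c : I -> quat R) : H :=
  lim (partial_sum (fun k => rscale (F k) (c k)) @ totally).

(* T_F^* x = (<f_k, x>)_k *)
Definition analysis F x : I -> quat R := fun k => dot (F k) x.

Definition is_approx_Kdual K F G := bessel G /\
  (opnorm (fun x => (K x - synthesis F (analysis G x))%R) < 1)%E.

(* P_{R(K)} T_F T_G^* K^dagger *)
Definition Psi K F G x : H :=
  orth_proj (range K) (synthesis F (analysis G (pseudo_inverse K x))).

End Frames.

(* Main.v *)
(* Write P for the projection onto R(K), D for K^dagger and V for T_F T_G^*.
   Since K D is the identity on R(K), there x - Psi x = P (K - V) D x, whose norm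
   is at most |K - V| |x|; as |K - V| < 1, the operator Psi is invertible on R(K)
   by the contraction principle. Put L = Psi^-1 P. Then L V D = P, because D
   vanishes on R(K)^perp. Applying L to the expansion of V (D (K x)) along F gives
   L V D K x = K x, which is the duality in (a). Taking adjoints, D^* V^* L^* = P,
   so applying D^* to the expansion of V^* (L^* (K x)) along G gives the duality
   in (b). Finally a Bessel sequence F' with a Bessel K-dual G' is a K-frame:
   |K^* x|^2 = <x, K K^* x> is a sum of terms <x, f'_k> <g'_k, K^* x>, and AM-GM
   bounds it from above by the frame sum of F'. *)

Require Import Defs.
From mathcomp Require Import all_boot all_order all_algebra.
From mathcomp Require Import finmap ring lra.
From mathcomp Require Import all_classical all_reals ereal topology normedtype.
From mathcomp Require Import sequences esum analysis.showcase.summability.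

Import Order.TTheory GRing.Theory Num.Theory.
Import numFieldNormedType.Exports.
Local Open Scope classical_set_scope.
Local Open Scope ring_scope.

Set Implicit Arguments.
Unset Strict Implicit.
Unset Printing Implicit Defensive.

(** * Quaternions and the inner product *)

Section Quaternions.
Variable R : realType.
Implicit Types (p q : quat R) (a : R).

Lemma quat_eq p q : qre p = qre q -> qi p = qi q -> qj p = qj q ->
  qk p = qk q -> p = q.
Proof. by case: p q => [????] [????] /= -> -> -> ->. Qed.

Lemma qreD p q : qre (p + q) = qre p + qre q. Proof. by []. Qed.

Lemma qreN p : qre (- p) = - qre p. Proof. by []. Qed.

Lemma qconjK p : qconj (qconj p) = p.
Proof. by apply: quat_eq => /=; rewrite ?opprK. Qed.

Lemma qconjD p q : qconj (p + q) = qconj p + qconj q.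
Proof. by apply: quat_eq => /=; rewrite ?opprD. Qed.

Lemma qconjM p q : qconj (p * q) = qconj q * qconj p.
Proof. by apply: quat_eq => /=; ring. Qed.

Lemma qconj0 : qconj (0 : quat R) = 0.
Proof. by apply: quat_eq => /=; rewrite ?oppr0. Qed.

Lemma qre_realM a p : qre (qreal a * p) = a * qre p.
Proof. by rewrite /=; ring. Qed.

Lemma qrealM_comm a p : qreal a * p = p * qreal a.
Proof. by apply: quat_eq => /=; ring. Qed.

Lemma qrealM a (b : R) : qreal a * qreal b = qreal (a * b).
Proof. by apply: quat_eq => /=; ring. Qed.

Lemma qreal0 : qreal (0 : R) = 0. Proof. by []. Qed.

Lemma qreal1 : qreal (1 : R) = 1. Proof. by []. Qed.

Lemma sqr_qnorm p :
  qnorm p ^+ 2 = qre p ^+ 2 + qi p ^+ 2 + qj p ^+ 2 + qk p ^+ 2.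
Proof. by rewrite sqr_sqrtr// !addr_ge0// sqr_ge0. Qed.

Lemma qnorm_ge0 p : 0 <= qnorm p. Proof. exact: sqrtr_ge0. Qed.

Lemma qnorm_conj p : qnorm (qconj p) = qnorm p.
Proof. by rewrite /qnorm /= !sqrrN. Qed.

Lemma qnorm_eq0 p : qnorm p = 0 -> p = 0.
Proof.
move=> p0; have := sqr_qnorm p; rewrite p0 expr0n /= => /esym /eqP.
rewrite !paddr_eq0 ?addr_ge0 ?sqr_ge0// !sqrf_eq0.
by move=> /andP[/andP[/andP[/eqP ? /eqP ?] /eqP ?] /eqP ?]; apply: quat_eq.
Qed.

Lemma qconj_mul p : qconj p * p = qreal (qnorm p ^+ 2).
Proof. by rewrite sqr_qnorm; apply: quat_eq => /=; ring. Qed.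

Lemma qmul_conj p : p * qconj p = qreal (qnorm p ^+ 2).
Proof. by rewrite -(qnorm_conj p) -qconj_mul qconjK. Qed.

(** Weighted AM-GM: the difference of the two sides is [|conj p - a q|^2 / a], written out in
    coordinates. *)
Lemma qre_mul_le p q a : 0 < a ->
  2 * qre (p * q) <= qnorm p ^+ 2 / a + a * qnorm q ^+ 2.
Proof.
move=> a0; rewrite !sqr_qnorm -subr_ge0.
have -> : (qre p ^+ 2 + qi p ^+ 2 + qj p ^+ 2 + qk p ^+ 2) / a +
    a * (qre q ^+ 2 + qi q ^+ 2 + qj q ^+ 2 + qk q ^+ 2) - 2 * qre (p * q) =
  a^-1 * ((qre p - a * qre q) ^+ 2 + (qi p + a * qi q) ^+ 2 +
          (qj p + a * qj q) ^+ 2 + (qk p + a * qk q) ^+ 2).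
  by rewrite /=; field; rewrite gt_eqF.
by rewrite mulr_ge0 ?invr_ge0 ?(ltW a0)// !addr_ge0// sqr_ge0.
Qed.

End Quaternions.

(** * Algebra of the inner product, norm identities and Cauchy-Schwarz *)

Section Hilbert.
Variables (R : realType) (H : quatHilbertType R).
Implicit Types (x y z : H) (p q : quat R) (M : set H) (T S : H -> H).

Lemma rscale1 x : rscale x 1 = x.
Proof. by rewrite -qreal1 rscale_real scale1r. Qed.

Lemma rscaler0 x : rscale x 0 = 0.
Proof. by rewrite -qreal0 rscale_real scale0r. Qed.

Lemma rscale0r q : rscale (0 : H) q = 0.
Proof. by apply: (addIr (rscale 0 q)); rewrite -rscaleDl !add0r. Qed.

Lemma rscalerN1 x : rscale x (qreal (-1)) = - x.
Proof. by rewrite rscale_real scaleN1r. Qed.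

Lemma rscaleNl x q : rscale (- x) q = - rscale x q.
Proof. by apply: (addIr (rscale x q)); rewrite -rscaleDl !addNr rscale0r. Qed.

Lemma dotDl x y z : dot (x + y) z = dot x z + dot y z.
Proof. by rewrite -dot_conj dotDr qconjD !dot_conj. Qed.

Lemma dotZl x y q : dot (rscale x q) y = qconj q * dot x y.
Proof. by rewrite -dot_conj dotZr qconjM !dot_conj. Qed.

Lemma dotr0 x : dot x 0 = 0.
Proof. by rewrite -(rscaler0 0) dotZr mulr0. Qed.

Lemma dot0r x : dot 0 x = 0.
Proof. by rewrite -dot_conj dotr0 qconj0. Qed.

Lemma dotNr x y : dot x (- y) = - dot x y.
Proof. by apply: (addIr (dot x y)); rewrite -dotDr !addNr dotr0. Qed.

Lemma dotNl x y : dot (- x) y = - dot x y.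
Proof. by apply: (addIr (dot x y)); rewrite -dotDl !addNr dot0r. Qed.

Lemma dotBr x y z : dot x (y - z) = dot x y - dot x z.
Proof. by rewrite dotDr dotNr. Qed.

Lemma dotBl x y z : dot (x - y) z = dot x z - dot y z.
Proof. by rewrite dotDl dotNl. Qed.

Lemma qre_dotC x y : qre (dot x y) = qre (dot y x).
Proof. by rewrite -dot_conj. Qed.

Lemma dot_sumr (J : Type) (s : seq J) x (u : J -> H) :
  dot x (\sum_(i <- s) u i) = \sum_(i <- s) dot x (u i).
Proof.
by elim: s => [|i s IH]; rewrite ?big_nil ?dotr0// !big_cons dotDr IH.
Qed.

Lemma qre_dotxx x : qre (dot x x) = `|x| ^+ 2.
Proof. by rewrite dotxx. Qed.

(** Testing against [z = x - y] gives [|x - y|^2 = 0]. Identities between vectors, in particular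
    those involving adjoints, can therefore be checked on real parts. *)
Lemma qre_dot_ext x y : (forall z, qre (dot x z) = qre (dot y z)) -> x = y.
Proof.
move=> xy; apply/subr0_eq/eqP; rewrite -normr_eq0 -sqrf_eq0 -qre_dotxx.
by rewrite dotBl qreD qreN xy subrr.
Qed.

Lemma sqr_normD x y :
  `|x + y| ^+ 2 = `|x| ^+ 2 + 2 * qre (dot x y) + `|y| ^+ 2.
Proof.
rewrite -!qre_dotxx dotDl !dotDr !qreD (qre_dotC y x); ring.
Qed.

Lemma sqr_normB x y :
  `|x - y| ^+ 2 = `|x| ^+ 2 - 2 * qre (dot x y) + `|y| ^+ 2.
Proof. by rewrite sqr_normD normrN dotNr qreN mulrN. Qed.

Lemma parallelogram x y :
  `|x + y| ^+ 2 + `|x - y| ^+ 2 = 2 * `|x| ^+ 2 + 2 * `|y| ^+ 2.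
Proof. rewrite sqr_normD sqr_normB; ring. Qed.

Lemma norm_rscale x q : `|rscale x q| = `|x| * qnorm q.
Proof.
apply/eqP; rewrite -(@eqrXn2 _ 2)// ?mulr_ge0 ?qnorm_ge0//.
rewrite -qre_dotxx dotZr dotZl dotxx -mulrA qrealM_comm mulrA qconj_mul qrealM.
by rewrite /= exprMn mulrC.
Qed.

(* The triangle inequality of the given norm already contains the real part of
   Cauchy-Schwarz; the rest follows by rotating [y]. *)
Lemma qre_dot_le x y : qre (dot x y) <= `|x| * `|y|.
Proof.
have : `|x + y| ^+ 2 <= (`|x| + `|y|) ^+ 2.
  by rewrite lerXn2r ?nnegrE ?addr_ge0// ler_normD.
rewrite sqr_normD; have := normr_ge0 x; have := normr_ge0 y; nra.
Qed.

Lemma cauchy_schwarz x y : qnorm (dot x y) <= `|x| * `|y|.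
Proof.
have := qre_dot_le x (rscale y (qconj (dot x y))).
rewrite dotZr qmul_conj norm_rscale qnorm_conj /= mulrA expr2.
have := qnorm_ge0 (dot x y); rewrite le_eqVlt => /orP[/eqP <- _|d0].
  by rewrite mulr_ge0.
by rewrite ler_pM2r.
Qed.

End Hilbert.

(** * Orthogonal projections *)

Section Projection.
Variables (R : realType) (H : quatHilbertType R).
Implicit Types (x y z : H) (p q : quat R) (M : set H) (T S : H -> H).

Definition right_subspace M :=
  M 0 /\ forall x y p q, M x -> M y -> M (rscale x p + rscale y q).

Lemma subspaceB M x y : right_subspace M -> M x -> M y -> M (x - y).
Proof.
move=> [_ lM] Mx My; have := lM x y 1 (qreal (-1)) Mx My.
by rewrite rscale1 rscalerN1.
Qed.

Lemma subspaceD M x y : right_subspace M -> M x -> M y -> M (x + y).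
Proof. by move=> [_ lM] Mx My; have := lM x y 1 1 Mx My; rewrite !rscale1. Qed.

Lemma subspaceZ M x q : right_subspace M -> M x -> M (rscale x q).
Proof.
by move=> [M0 lM] Mx; have := lM x 0 q 1 Mx M0; rewrite rscale0r addr0.
Qed.

Lemma closed_approxP M : closed M <->
  forall x, (forall e, 0 < e -> exists2 m, M m & `|x - m| < e) -> M x.
Proof.
split=> [clM x Mx|clM x Mx].
  apply: clM => B /nbhs_ballP[e /= e0 eB]; have [m Mm xm] := Mx e e0.
  by exists m; split=> //; apply: eB; rewrite -ball_normE.
apply: clM => e e0; have [m [Mm]] := Mx _ (nbhsx_ballx x e e0).
by rewrite -ball_normE => xm; exists m.
Qed.

Lemma subspace_orth M : right_subspace (orth M).
Proof.
split=> [m _|x y p q Mx My m Mm]; first exact: dotr0.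
by rewrite dotDr !dotZr Mx// My// !mul0r addr0.
Qed.

(** Along with [m], a right subspace contains [m <m, x>], whose inner product with [x] is the real
    number [|<m, x>|^2]. *)
Lemma orth_qre M x : right_subspace M ->
  (forall m, M m -> qre (dot m x) = 0) -> orth M x.
Proof.
move=> sM Mx m Mm; have := Mx _ (subspaceZ (dot m x) sM Mm).
by rewrite dotZl qconj_mul => /eqP; rewrite sqrf_eq0 => /eqP /qnorm_eq0.
Qed.

Lemma orth_meet M x : M x -> orth M x -> x = 0.
Proof.
move=> Mx /(_ _ Mx) xx; apply/eqP; rewrite -normr_eq0 -sqrf_eq0 -qre_dotxx.
by rewrite xx.
Qed.

(** First variation: moving from [m] to [m + t y] with [t] real cannot decrease the distance to [x],
    so a quadratic in [t] with linear coefficient [-2 r] stays nonnegative, which forces [r = 0]. *)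
Lemma nearest_point_orth M x m : right_subspace M -> M m ->
  (forall y, M y -> `|x - m| <= `|x - y|) -> orth M (x - m).
Proof.
move=> sM Mm mmin; apply: orth_qre => // y My.
set r := qre _; set v := x - m.
have ineq t : 0 <= t ^+ 2 * `|y| ^+ 2 - 2 * t * r.
  have := mmin _ (subspaceD sM Mm (subspaceZ (qreal t) sM My)).
  rewrite -(@ler_pXn2r _ 2) ?nnegrE// opprD addrA -/v (sqr_normB v) norm_rscale.
  rewrite dotZr -qrealM_comm qre_realM exprMn sqr_qnorm /= qre_dotC -/r.
  lra.
apply/eqP; have [//|rn0] := eqVneq r 0.
(* The minimiser would be [r / |y|^2]; the added 1 keeps the denominator positive when [y = 0], and
   the value is still negative. *)
have := ineq (r / (`|y| ^+ 2 + 1)); set n := `|y| ^+ 2.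
have n0 : 0 < n + 1 by rewrite ltr_wpDl// sqr_ge0.
have -> : (r / (n + 1)) ^+ 2 * n - 2 * (r / (n + 1)) * r =
  - (r ^+ 2 * (n + 2) / (n + 1) ^+ 2) by field; rewrite gt_eqF.
rewrite oppr_ge0 leNgt divr_gt0 ?exprn_gt0// mulr_gt0//.
  by rewrite exprn_even_gt0.
by move: n0; lra.
Qed.

(* The near-minimisers of the distance to [M] form a Cauchy filter base by the
   parallelogram law. *)
Lemma projection_exists M x : right_subspace M -> closed M ->
  exists2 m, M m & orth M (x - m).
Proof.
move=> sM clM; pose D := [set `|x - m| | m in M].
have infD : has_inf D.
  split; first by exists `|x - 0|, 0; case: sM.
  by exists 0 => _ [m _ <-].
set d := inf D.
have d_le m : M m -> d <= `|x - m|.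
  by move=> Mm; apply: ge_inf; [case: infD|exists m].
have d0 : 0 <= d.
  by apply: lb_le_inf; [case: infD|move=> _ [m _ <-]].
pose N e := [set m | M m /\ `|x - m| < d + e].
have N0 e : 0 < e -> N e !=set0.
  move=> e0; have [_ [m Mm <-] xm] := inf_adherent e0 infD.
  by exists m.
(* The midpoint of [m] and [y] lies in [M], hence at distance at least [d] from [x]; the
   parallelogram law then gives the bound [4 (d + e)^2 - 4 d^2]. *)
have N_close e m y : N e m -> N e y -> `|m - y| ^+ 2 <= 4 * e * (2 * d + e).
  move=> [Mm mlt] [My ylt].
  have half : M (rscale (m + y) (qreal 2^-1)).
    by apply: subspaceZ => //; exact: subspaceD.
  have := parallelogram (x - m) (x - y).
  have -> : x - m + (x - y) = 2 *: (x - rscale (m + y) (qreal 2^-1)).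
    rewrite rscale_real scalerBr scalerA divff// scale1r scaler_nat mulr2n.
    by rewrite opprD addrACA.
  have -> : x - m - (x - y) = y - m.
    by rewrite opprB addrC addrA subrK.
  rewrite normrZ exprMn ger0_norm// (distrC y m).
  have := d_le _ half; set h := `|_ - rscale _ _| => dh.
  have hh : d ^+ 2 <= h ^+ 2 by rewrite lerXn2r ?nnegrE// (le_trans d0).
  have sq z : `|x - z| < d + e -> `|x - z| ^+ 2 <= (d + e) ^+ 2.
    move=> zlt; rewrite lerXn2r ?nnegrE ?(ltW zlt)//.
    by rewrite (le_trans _ (ltW zlt)).
  have := sq _ mlt; have := sq _ ylt; lra.
pose Fl := filter_from [set e : R | 0 < e] N.
have FF : ProperFilter Fl.
  apply: filter_from_proper; last by move=> e /N0.
  apply: filter_from_filter; first by exists 1 => /=.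
  move=> e f /= e0 f0; exists (Num.min e f); first by rewrite /= lt_min e0.
  move=> m [Mm]; rewrite -ltrBlDl lt_min => /andP[me mf].
  by split; split=> //; rewrite -ltrBlDl.
have cF : cauchy Fl.
  apply: cauchy_exP => eps eps0.
  (* Since [e <= 1], the bound of [N_close] is at most [4 e (2 d + 1)]; the larger factor [2 d + 2]
     makes the comparison with [eps^2] strict. *)
  pose e := Num.min 1 (eps ^+ 2 / (4 * (2 * d + 2))).
  have D0 : 0 < 4 * (2 * d + 2) by lra.
  have e0 : 0 < e by rewrite lt_min ltr01 divr_gt0// exprn_gt0.
  have e1 : e <= 1 by rewrite ge_min lexx.
  have [m Nm] := N0 e e0; exists m, e => //= y Ny; rewrite -ball_normE /=.
  rewrite -(@ltr_pXn2r _ 2) ?nnegrE ?(ltW eps0)//.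
  apply: (le_lt_trans (N_close _ _ _ Nm Ny)).
  have : e * (4 * (2 * d + 2)) <= eps ^+ 2.
    by rewrite -ler_pdivlMr// ge_min lexx orbT.
  nra.
have /cauchy_cvgP /cvg_ex[m Fm] := cF.
have approx e : 0 < e -> exists2 y, N e y & `|m - y| < e.
  move=> e0; have [f /= f0 fm] := Fm _ (nbhsx_ballx m e e0).
  have [y [My]] : N (Num.min e f) !=set0 by apply: N0; rewrite lt_min e0.
  rewrite -ltrBlDl lt_min => /andP[ye yf]; exists y.
    by split=> //; rewrite -ltrBlDl.
  have : N f y by split=> //; rewrite -ltrBlDl.
  by move/fm; rewrite -ball_normE.
have Mm : M m.
  move/closed_approxP : clM; apply => e e0.
  by have [y [My _] ym] := approx e e0; exists y.
(* As a limit of near-minimisers, [m] is at distance at most [d + e] from [x] for every [e > 0],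
   hence at most [d]. *)
exists m => //; apply: nearest_point_orth => // y /d_le; apply: le_trans.
apply/ler_addgt0Pr => e e0; have e20 : 0 < e / 2 by rewrite divr_gt0.
have [z [_ xz] mz] := approx _ e20; rewrite (le_trans (ler_distD z _ _))//.
rewrite (distrC z m); lra.
Qed.

Lemma orth_projP M x : right_subspace M -> closed M ->
  M (orth_proj M x) /\ orth M (x - orth_proj M x).
Proof.
move=> sM clM; have [m Mm xm] := projection_exists x sM clM.
apply: (@xgetPex _ 0 [set m | M m /\ orth M (x - m)]).
by exists m.
Qed.

End Projection.

(** * Bounded operators and adjoints *)

Section BoundedOperators.
Variables (R : realType) (H : quatHilbertType R).
Implicit Types (x y z : H) (p q : quat R) (M : set H) (T S : H -> H).

Lemma right_linearD T x y : right_linear T -> T (x + y) = T x + T y.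
Proof. by move=> lT; have := lT x y 1 1; rewrite !rscale1. Qed.

Lemma right_linear0 T : right_linear T -> T 0 = 0.
Proof. by move=> lT; apply: (addIr (T 0)); rewrite -right_linearD// !add0r. Qed.

Lemma right_linearZ T x q : right_linear T -> T (rscale x q) = rscale (T x) q.
Proof.
by move=> lT; have := lT x 0 q 0; rewrite !rscaler0 !addr0.
Qed.

Lemma right_linearB T x y : right_linear T -> T (x - y) = T x - T y.
Proof. by move=> lT; rewrite right_linearD// -!rscalerN1 right_linearZ. Qed.

Lemma right_linear_sum T (J : Type) (s : seq J) (u : J -> H) :
  right_linear T -> T (\sum_(i <- s) u i) = \sum_(i <- s) T (u i).
Proof.
move=> lT; elim: s => [|i s IH]; first by rewrite !big_nil right_linear0.
by rewrite !big_cons right_linearD// IH.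
Qed.

Lemma right_linear_comp T S :
  right_linear T -> right_linear S -> right_linear (T \o S).
Proof. by move=> lT lS x y p q; rewrite /= lS lT. Qed.

Lemma right_linear_sub T S : right_linear T -> right_linear S ->
  right_linear (fun x => T x - S x).
Proof.
move=> lT lS x y p q; rewrite lS lT !rscaleDl !rscaleNl opprD.
by rewrite addrACA.
Qed.

Lemma bounded_op_ge0 T : bounded_op T ->
  exists2 C : R, 0 <= C & forall x, `|T x| <= C * `|x|.
Proof.
move=> [C TC]; exists `|C| => // x; apply: (le_trans (TC x)).
by rewrite ler_wpM2r// ler_norm.
Qed.

Lemma bounded_op_comp T S : bounded_op T -> bounded_op S -> bounded_op (T \o S).
Proof.
move=> /bounded_op_ge0[C C0 TC] [D SD]; exists (C * D) => x /=.
by rewrite (le_trans (TC _))// -mulrA ler_wpM2l.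
Qed.

Lemma opnorm_le T (c : R) : right_linear T -> (opnorm T <= c%:E)%E ->
  forall x, `|T x| <= c * `|x|.
Proof.
move=> lT Tc x; have [->|x0] := eqVneq x 0.
  by rewrite right_linear0// !normr0 mulr0.
have nx : 0 < `|x| by rewrite normr_gt0.
have : (`|T (rscale x (qreal `|x|^-1))|%:E <= c%:E)%E.
  apply: le_trans Tc; apply: ereal_sup_ubound.
  exists (rscale x (qreal `|x|^-1)) => //=.
  by rewrite rscale_real normrZ gtr0_norm ?invr_gt0// mulVf ?gt_eqF.
rewrite lee_fin right_linearZ// rscale_real normrZ gtr0_norm ?invr_gt0//.
by rewrite mulrC ler_pdivrMr.
Qed.

Lemma opnorm_lt1 T : right_linear T -> (opnorm T < 1)%E ->
  exists c : R, [/\ 0 <= c, c < 1 & forall x, `|T x| <= c * `|x|].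
Proof.
move=> lT; have : (0 <= opnorm T)%E.
  apply: ereal_sup_ubound; exists 0; first by rewrite /= normr0.
  by rewrite right_linear0// normr0.
case E : (opnorm T) => [c| |] //; rewrite lee_fin lte_fin => c0 c1.
by exists c; split=> //; apply: opnorm_le => //; rewrite E.
Qed.

Lemma subspace_range T : right_linear T -> right_subspace (range T).
Proof.
move=> lT; split=> [|_ _ p q [x _ <-] [y _ <-]].
  by exists 0; [|exact: right_linear0].
by exists (rscale x p + rscale y q); [|exact: lT].
Qed.

Lemma subspace_kernel T : right_linear T -> right_subspace (kernel T).
Proof.
move=> lT; split=> [|x y p q xT yT]; first exact: right_linear0.
by rewrite /kernel /= lT xT yT !rscale0r addr0.
Qed.

Lemma le_eps_eq0 (a C : R) : 0 <= a -> (forall e, 0 < e -> a <= C * e) -> a = 0.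
Proof.
move=> a0 aC; apply/eqP; rewrite eq_le a0 andbT; apply/ler_addgt0Pr => e e0.
rewrite add0r; have C0 : 0 < `|C| + 1 by rewrite ltr_wpDl.
apply: (le_trans (aC _ (divr_gt0 e0 C0))).
rewrite mulrA ler_pdivrMr// mulrC ler_pM2l//.
by rewrite (le_trans (ler_norm _))// lerDl.
Qed.

Lemma closed_kernel T : right_linear T -> bounded_op T -> closed (kernel T).
Proof.
move=> lT [C TC]; apply/closed_approxP => x xT.
apply/eqP; rewrite -normr_eq0; apply/eqP/(@le_eps_eq0 _ `|C|) => // e e0.
have [m mT xm] := xT e e0; rewrite -(subr0 (T x)) -[in X in T x - X]mT.
rewrite -right_linearB// (le_trans (TC _))//.
by rewrite (le_trans (ler_norm _))// normrM normr_id ler_wpM2l// ltW.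
Qed.

(** The kernel [N] of [phi] is closed by the bound. If [phi] is not zero, take [z] orthogonal to [N]
    with [a = phi z] nonzero and [a b = 1]: every [x] differs from [z b (phi x)] by an element of
    [N], so [<z, x> = |z|^2 b (phi x)]. *)
Lemma riesz (phi : H -> quat R) (C : R) :
  {morph phi : x y / x + y} -> (forall x q, phi (rscale x q) = phi x * q) ->
  (forall x, qnorm (phi x) <= C * `|x|) ->
  exists y, forall x, phi x = dot y x.
Proof.
move=> phiD phiZ phiC.
have phi0 : phi 0 = 0 by apply: (addIr (phi 0)); rewrite -phiD !add0r.
have phiB x y : phi (x - y) = phi x - phi y.
  rewrite phiD; congr (_ + _); apply: (addIr (phi y)).
  by rewrite -phiD !addNr.
pose N := [set x | phi x = 0].
have sN : right_subspace N.
  split=> [//|x y p q px py].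
  by rewrite /N /= phiD !phiZ px py !mul0r addr0.
have clN : closed N.
  apply/closed_approxP => x xN; apply/qnorm_eq0.
  apply: (@le_eps_eq0 _ `|C|) => [|e e0]; first exact: qnorm_ge0.
  have [m mN xm] := xN e e0; rewrite -(subr0 (phi x)) -[in X in phi x - X]mN.
  rewrite -phiB (le_trans (phiC _))//.
  by rewrite (le_trans (ler_norm _))// normrM normr_id ler_wpM2l// ltW.
have [phi_eq0|/existsNP[x0 x0phi]] := pselect (forall x, phi x = 0).
  by exists 0 => x; rewrite phi_eq0 dot0r.
have [Pm Po] := orth_projP x0 sN clN.
set z := x0 - _ in Po; set a := phi z.
have a0 : a <> 0 by rewrite /a phiB Pm subr0.
have na : qnorm a ^+ 2 != 0.
  by rewrite sqrf_eq0; apply/eqP => /qnorm_eq0.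
have nz : `|z| ^+ 2 != 0.
  rewrite sqrf_eq0 normr_eq0; apply/eqP => z0; apply: a0.
  by rewrite /a z0.
have [b ab] : exists b, a * b = 1.
  exists (qconj a * qreal (qnorm a ^- 2)).
  by rewrite mulrA qmul_conj qrealM divff// qreal1.
(* Conjugation undoes the conjugate linearity of the first slot: this vector pairs with [x] to
   [a |z|^-2 <z, x> = a b (phi x) = phi x]. *)
exists (rscale z (qconj (a * qreal (`|z| ^- 2)))) => x.
rewrite dotZl qconjK.
have : N (x - rscale z (b * phi x)).
  by rewrite /N /= phiB phiZ -/a mulrA ab mul1r subrr.
move/Po => /(congr1 (@qconj R)); rewrite dot_conj qconj0 dotBr dotZr dotxx.
move/subr0_eq ->; rewrite !mulrA -(mulrA a) qrealM mulVf// qreal1 mulr1 ab.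
by rewrite mul1r.
Qed.

(** Riesz is applied to [x |-> <y, T x>], with [T x] in the second slot, where the form is right
    linear; conjugating gives the stated order. *)
Lemma adjoint_exists T : right_linear T -> bounded_op T ->
  exists S, forall x y, dot (T x) y = dot x (S y).
Proof.
move=> lT /bounded_op_ge0[C C0 TC].
have repr y : exists s, forall x, dot y (T x) = dot s x.
  apply: (@riesz _ (`|y| * C)) => [x z|x q|x].
  - by rewrite right_linearD// dotDr.
  - by rewrite right_linearZ// dotZr.
  - by rewrite (le_trans (cauchy_schwarz _ _))// -mulrA ler_wpM2l.
have [S SP] := choice repr; exists S => x y.
by rewrite -dot_conj SP dot_conj.
Qed.

Lemma adjointP T : right_linear T -> bounded_op T ->
  forall x y, dot (T x) y = dot x (adjoint T y).
Proof.
move=> lT bT; have [S SP] := adjoint_exists lT bT.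
exact: (@xgetPex _ (fun=> 0)
  [set S | forall x y, dot (T x) y = dot x (S y)]) (ex_intro _ S SP).
Qed.

Lemma adjointPl T : right_linear T -> bounded_op T ->
  forall x y, dot (adjoint T x) y = dot x (T y).
Proof. by move=> lT bT x y; rewrite -dot_conj -adjointP// dot_conj. Qed.

Lemma right_linear_adjoint T : right_linear T -> bounded_op T ->
  right_linear (adjoint T).
Proof.
move=> lT bT x y p q; apply: qre_dot_ext => z.
by rewrite adjointPl// !dotDl !dotZl !adjointPl.
Qed.

Lemma bounded_op_adjoint T : right_linear T -> bounded_op T ->
  bounded_op (adjoint T).
Proof.
move=> lT bT; have [C C0 TC] := bounded_op_ge0 bT; exists C => x.
have : `|adjoint T x| ^+ 2 <= `|x| * (C * `|adjoint T x|).
  by rewrite -qre_dotxx adjointPl// (le_trans (qre_dot_le _ _))// ler_wpM2l.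
have := normr_ge0 (adjoint T x); rewrite le_eqVlt => /orP[/eqP <- _|a0].
  by rewrite mulr_ge0.
by rewrite mulrCA mulrA expr2 ler_pM2r.
Qed.

(** * The projection as an operator, and inversion of operators close to the identity *)

Section OrthogonalProjection.
Variable M : set H.
Hypotheses (sM : right_subspace M) (clM : closed M).

Lemma orth_proj_in x : M (orth_proj M x).
Proof. by case: (orth_projP x sM clM). Qed.

Lemma orth_proj_orth x : orth M (x - orth_proj M x).
Proof. by case: (orth_projP x sM clM). Qed.

(** The difference of the two candidates lies both in [M] and in its orthogonal complement. *)
Lemma orth_proj_eq x m : M m -> orth M (x - m) -> orth_proj M x = m.
Proof.
move=> Mm xm; apply/esym/subr0_eq/(@orth_meet _ _ M).
  by apply: subspaceB => //; exact: orth_proj_in.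
have -> : m - orth_proj M x = (x - orth_proj M x) - (x - m).
  by rewrite opprB [RHS]addrC addrA subrK.
exact: (subspaceB (subspace_orth M) (orth_proj_orth x) xm).
Qed.

Lemma orth_proj_id x : M x -> orth_proj M x = x.
Proof.
by move=> Mx; apply: orth_proj_eq => // m _; rewrite subrr dotr0.
Qed.

Lemma orth_proj_eq0 x : orth M x -> orth_proj M x = 0.
Proof. by move=> Mx; apply: orth_proj_eq; rewrite ?subr0//; case: sM. Qed.

Lemma right_linear_orth_proj : right_linear (orth_proj M).
Proof.
move=> x y p q; apply: orth_proj_eq; first by apply: sM.2; exact: orth_proj_in.
rewrite opprD addrACA -!rscaleNl -!rscaleDl.
by apply: (subspace_orth M).2; exact: orth_proj_orth.
Qed.

Lemma norm_orth_proj x : `|orth_proj M x| <= `|x|.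
Proof.
rewrite -(@ler_pXn2r _ 2) ?nnegrE//.
rewrite -[in leRHS](subrK (orth_proj M x) x) addrC sqr_normD.
by rewrite (@orth_proj_orth x _ (orth_proj_in x)) mulr0 addr0 lerDl sqr_ge0.
Qed.

Lemma bounded_op_orth_proj : bounded_op (orth_proj M).
Proof. by exists 1 => x; rewrite mul1r norm_orth_proj. Qed.

Lemma dot_orth_proj m x : M m -> dot m (orth_proj M x) = dot m x.
Proof.
move=> Mm; apply/esym/subr0_eq; rewrite -dotBr.
exact: orth_proj_orth.
Qed.

(** A solution of [T x = y] is a fixed point of [x |-> x - T x + y], which maps [M] to itself and is
    a contraction there. *)
Lemma contraction_solve T c : c < 1 -> (forall x, M x -> M (T x)) ->
  (forall x y, M x -> M y -> `|(x - T x) - (y - T y)| <= c * `|x - y|) ->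
  forall y, M y -> exists2 x, M x & T x = y.
Proof.
move=> c1 MT Tc y My; pose f x := x - T x + y.
have Mf x : M x -> M (f x).
  by move=> Mx; apply: subspaceD => //; apply: subspaceB => //; exact: MT.
pose f' : {fun M >-> M} := mkfun_fun Mf.
(* The sign of [c] is unknown, while a contraction constant must be nonnegative. *)
have c'0 : 0 <= Num.max 0 c by rewrite le_max lexx.
have ctr : is_contraction f'.
  exists (NngNum c'0); split=> /=; first by rewrite gt_max ltr01.
  move=> [u v] /= [Mu Mv]; rewrite /f opprD addrACA subrr addr0.
  by rewrite (le_trans (Tc _ _ Mu Mv))// ler_wpM2r// le_max lexx orbT.
have [//|x Mx xf] := banach_fixed_point ctr clM; first by exists 0; case: sM.
exists x => //; move/eqP: xf; rewrite /= /f -subr_eq0 opprD opprB addrA.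
by rewrite addrCA subrr addr0 subr_eq0 => /eqP.
Qed.

(** Surjectivity comes from [contraction_solve]. The estimate [(1 - c) |x| <= |T x|] gives both
    injectivity and the bound [1 / (1 - c)] on the inverse. *)
Lemma near_id_inverse T c : operator_on M T -> c < 1 ->
  (forall x, M x -> `|x - T x| <= c * `|x|) -> exists S, inverse_on M T S.
Proof.
move=> [MT lT _] c1 Tc.
have TB x y : M x -> M y -> T (x - y) = T x - T y.
  move=> Mx My; have := lT x y 1 (qreal (-1)) Mx My.
  by rewrite !rscale1 !rscalerN1.
have solve : forall y, M y -> exists2 x, M x & T x = y.
  apply: (contraction_solve c1 MT) => x y Mx My.
  have -> : x - T x - (y - T y) = (x - y) - T (x - y).
    by rewrite TB// !opprD !opprK addrACA.
  by apply: Tc; exact: subspaceB.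
have Tge x : M x -> (1 - c) * `|x| <= `|T x|.
  move=> Mx; have := Tc x Mx; have := ler_normD (x - T x) (T x).
  rewrite subrK; lra.
(* Off [M] the implication is vacuous, so choice yields a function on the whole space. *)
have solveT y : exists x, M y -> M x /\ T x = y.
  have [My|nMy] := pselect (M y); last by exists 0.
  by have [x Mx Txy] := solve y My; exists x.
have [S SP] := choice solveT.
have inj x y : M x -> M y -> T x = T y -> x = y.
  move=> Mx My Txy; apply/subr0_eq/eqP; rewrite -normr_eq0.
  have := Tge _ (subspaceB sM Mx My); rewrite TB// Txy subrr normr0.
  by rewrite pmulr_rle0 ?subr_gt0// normr_le0 normr_eq0.
exists S; split; last first.
  move=> x Mx; have [MSx TSx] := SP x Mx; split=> //.
  by have [MSTx TSTx] := SP _ (MT _ Mx); exact: inj.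
split=> [x /SP[]//|x y p q Mx My|].
  have [MSx TSx] := SP x Mx; have [MSy TSy] := SP y My.
  have [MSxy TSxy] := SP _ (sM.2 _ _ p q Mx My).
  by apply: inj; rewrite ?TSxy ?lT ?TSx ?TSy//; exact: sM.2.
exists (1 - c)^-1 => x Mx; have [MSx TSx] := SP x Mx.
by rewrite mulrC ler_pdivlMr ?subr_gt0// mulrC -{2}TSx; exact: Tge.
Qed.

End OrthogonalProjection.

End BoundedOperators.

(** * The pseudo-inverse *)

Section PseudoInverse.
Variables (R : realType) (H : quatHilbertType R) (T : H -> H).
Hypotheses (lT : right_linear T) (bT : bounded_op T) (clT : closed (range T)).

Let sR : right_subspace (range T) := subspace_range lT.
Let sN : right_subspace (kernel T) := subspace_kernel lT.
Let clN : closed (kernel T) := closed_kernel lT bT.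

Lemma orth_kernel_inj x y :
  orth (kernel T) x -> orth (kernel T) y -> T x = T y -> x = y.
Proof.
move=> Nx Ny Txy; apply/subr0_eq/(@orth_meet _ _ (kernel T)).
  by rewrite /kernel /= right_linearB// Txy subrr.
exact: (subspaceB (subspace_orth _)).
Qed.

Lemma orth_kernel_surj y :
  exists x, orth (kernel T) x /\ T x = orth_proj (range T) y.
Proof.
have [x _ <-] := orth_proj_in sR clT y.
exists (x - orth_proj (kernel T) x); split; first exact: orth_proj_orth.
by rewrite right_linearB// (orth_proj_in sN clN x) subr0.
Qed.

(** The value at [y] is the only preimage of the projection of [y] that is orthogonal to the kernel.
    Each clause then follows from injectivity of [T] on the complement of its kernel. *)
Lemma pseudo_inverseP : [/\ right_linear (pseudo_inverse T),
  forall x, orth (kernel T) x -> pseudo_inverse T (T x) = x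
  & forall y, orth (range T) y -> pseudo_inverse T y = 0].
Proof.
have [S SP] := choice orth_kernel_surj.
apply: (@xgetPex _ (fun=> 0) [set S | [/\ right_linear S,
  forall x, orth (kernel T) x -> S (T x) = x
  & forall y, orth (range T) y -> S y = 0]]).
exists S; split=> [x y p q|x Nx|y Ry].
- apply: orth_kernel_inj; first exact: (SP _).1.
    by apply: (subspace_orth _).2; exact: (SP _).1.
  by rewrite lT !(SP _).2 right_linear_orth_proj.
- apply: orth_kernel_inj => //; first exact: (SP _).1.
  by rewrite (SP _).2 orth_proj_id//; exists x.
- apply: orth_kernel_inj; first exact: (SP _).1.
    exact: (subspace_orth _).1.
  by rewrite (SP _).2 orth_proj_eq0// right_linear0.
Qed.

Lemma right_linear_pseudo_inverse : right_linear (pseudo_inverse T).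
Proof. by case: pseudo_inverseP. Qed.

Lemma pseudo_inverseK y : range T y -> T (pseudo_inverse T y) = y.
Proof.
case: pseudo_inverseP => _ TK _ Ry.
have [x [Nx Tx]] := orth_kernel_surj y.
by move: Tx; rewrite orth_proj_id// => <-; rewrite TK.
Qed.

Lemma pseudo_inverse_orth_proj y :
  pseudo_inverse T (orth_proj (range T) y) = pseudo_inverse T y.
Proof.
case: pseudo_inverseP => lS _ S0; apply/esym/subr0_eq.
by rewrite -right_linearB// S0//; exact: orth_proj_orth.
Qed.

End PseudoInverse.

(** * Unconditional sums and Bessel sequences *)

#[local] Existing Instance totally_filter.

Section UnconditionalSums.
Variables (R : realType) (H : quatHilbertType R) (I : countType).
Implicit Types (x y s t : H) (u v : I -> H) (A : {fset I}).

Lemma partial_sumE (V : zmodType) (u : I -> V) A :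
  partial_sum u A = \sum_(k <- A) u k.
Proof. by rewrite /partial_sum big_seq_fsetE. Qed.

Lemma has_sumP u s : has_sum u s <-> forall e : R, 0 < e ->
  exists A0 : {fset I}, forall A, (A0 `<=` A)%fset ->
    `|s - \sum_(k <- A) u k| < e.
Proof.
split=> [/cvgrPdist_lt us e /us[A0 _ A0P]|us].
  by exists A0 => A /A0P /=; rewrite partial_sumE.
apply/cvgrPdist_lt => e /us[A0 A0P]; exists A0 => // A /A0P /=.
by rewrite partial_sumE.
Qed.

Lemma has_sum_unique u s t : has_sum u s -> has_sum u t -> s = t.
Proof. exact: (@cvg_unique _ (@norm_hausdorff _ _)). Qed.

Lemma has_sum_map (T : H -> H) u s : right_linear T -> bounded_op T ->
  has_sum u s -> has_sum (T \o u) (T s).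
Proof.
move=> lT /bounded_op_ge0[C C0 TC] /has_sumP us; apply/has_sumP => e e0.
have C1 : 0 < C + 1 by rewrite ltr_wpDl.
have [A0 A0P] := us _ (divr_gt0 e0 C1); exists A0 => A /A0P.
rewrite -right_linear_sum// -right_linearB// ltr_pdivlMr// mulrC.
by apply: le_lt_trans; rewrite (le_trans (TC _))// ler_wpM2r// lerDl.
Qed.

Lemma has_sum_lin u v s t (p q : quat R) : has_sum u s -> has_sum v t ->
  has_sum (fun k => rscale (u k) p + rscale (v k) q)
    (rscale s p + rscale t q).
Proof.
move=> /has_sumP us /has_sumP vt; apply/has_sumP => e e0.
(* The factor 2 shares [e] between the two sums; the added 1 allows [z = 0]. *)
have D0 z : 0 < 2 * (qnorm z + 1) :> R.
  by rewrite mulr_gt0// ltr_wpDl// qnorm_ge0.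
have [A AP] := us _ (divr_gt0 e0 (D0 p)).
have [B BP] := vt _ (divr_gt0 e0 (D0 q)).
exists (A `|` B)%fset => E; rewrite fsubUset => /andP[/AP AE /BP BE].
have lin z (w : I -> H) :
    \sum_(k <- E) rscale (w k) z = rscale (\sum_(k <- E) w k) z.
  elim: (enum_fset E) => [|k r IH]; first by rewrite !big_nil rscale0r.
  by rewrite !big_cons rscaleDl IH.
rewrite big_split /= !lin opprD addrACA -!rscaleNl -!rscaleDl.
rewrite (le_lt_trans (ler_normD _ _))// !norm_rscale.
move: AE BE; rewrite !ltr_pdivlMr//.
set a := `|_|; set b := `|_|.
have a0 : 0 <= a := normr_ge0 _; have b0 : 0 <= b := normr_ge0 _.
move: a0 b0.
have := qnorm_ge0 p; have := qnorm_ge0 q; nra.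
Qed.

(** Continuity of the inner product, stated for real parts: these can be compared by order, and by
    [qre_dot_ext] they determine a vector. *)
Lemma has_sum_qre_dot x u s : has_sum u s ->
  (fun A => \sum_(k <- A) qre (dot x (u k))) @ totally --> qre (dot x s).
Proof.
move=> /has_sumP us; apply/cvgrPdist_lt => e e0.
have x1 : 0 < `|x| + 1 by rewrite ltr_wpDl.
have [A0 A0P] := us _ (divr_gt0 e0 x1); exists A0 => // A /A0P /=.
rewrite ltr_pdivlMr// => Ae.
have -> : \sum_(k <- A) qre (dot x (u k)) = qre (dot x (\sum_(k <- A) u k)).
  rewrite dot_sumr; elim: (enum_fset A) => [|k r IH]; first by rewrite !big_nil.
  by rewrite !big_cons IH.
rewrite -qreN -qreD -dotBr; move: Ae; set d := _ - _ => Ae.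
have := qre_dot_le x d; have := qre_dot_le x (- d).
rewrite dotNr qreN normrN ltr_norml; have := normr_ge0 x; have := normr_ge0 d.
move=> *; apply/andP; split; nra.
Qed.

Lemma has_sum_qre_dot_le x u s (c : R) : has_sum u s ->
  (forall A, \sum_(k <- A) qre (dot x (u k)) <= c) -> qre (dot x s) <= c.
Proof.
move=> us uc; apply: (closed_cvg _ (@closed_le R c) _ _ (has_sum_qre_dot us)).
by apply: nearW => A; exact: uc.
Qed.

Lemma has_sum_qre_dot_eq x y u v s t : has_sum u s -> has_sum v t ->
  (forall k, qre (dot x (u k)) = qre (dot y (v k))) ->
  qre (dot x s) = qre (dot y t).
Proof.
move=> us vt uv; have := has_sum_qre_dot (x := y) vt.
have <- : (fun A => \sum_(k <- A) qre (dot x (u k))) =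
          (fun A => \sum_(k <- A) qre (dot y (v k))).
  by apply/funext => A; apply: eq_bigr.
move=> ut; exact: (cvg_unique (@Rhausdorff R) (has_sum_qre_dot us) ut).
Qed.

End UnconditionalSums.

(** * Bessel sequences, synthesis, and the operators [T_F T_G^*] *)

Section BesselSequences.
Variables (R : realType) (H : quatHilbertType R) (I : countType).
Implicit Types (x y s t : H) (F G : I -> H) (A : {fset I}) (T : H -> H).

Lemma ge_frame_sum F x A :
  ((\sum_(k <- A) qnorm (dot x (F k)) ^+ 2)%:E <= frame_sum F x)%E.
Proof.
apply: esum_ge; exists [set` A]; first by split; [exact: finite_fset|].
by rewrite fsbig_finite//= set_fsetK sumEFin.
Qed.

Lemma frame_sum_le F x (c : R) :
  (forall A, \sum_(k <- A) qnorm (dot x (F k)) ^+ 2 <= c) ->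
  (frame_sum F x <= c%:E)%E.
Proof.
move=> Fc; apply: ge_ereal_sup => _ /= [X [finX _] <-].
by rewrite fsbig_finite//= sumEFin lee_fin.
Qed.

Lemma besselP F : bessel F <-> exists2 B : R, 0 < B & forall x A,
  \sum_(k <- A) qnorm (dot x (F k)) ^+ 2 <= B * `|x| ^+ 2.
Proof.
split=> -[B B0 FB]; exists B => //.
  by move=> x A; rewrite -lee_fin (le_trans _ (FB x))// ge_frame_sum.
by move=> x; apply: frame_sum_le.
Qed.

(** The hypothesis says that [F'] is the image of [F] under the adjoint of [T]; every family in the
    theorem arises in this way. *)
Lemma bessel_map F F' T : bessel F -> bounded_op T ->
  (forall x k, dot x (F' k) = dot (T x) (F k)) -> bessel F'.
Proof.
move=> /besselP[B B0 FB] /bounded_op_ge0[C C0 TC] FF'.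
apply/besselP; exists (B * (C ^+ 2 + 1)) => [|x A].
  by rewrite mulr_gt0// ltr_wpDl// sqr_ge0.
under eq_bigr do rewrite FF'.
rewrite (le_trans (FB _ _))// -mulrA ler_pM2l//.
have : `|T x| ^+ 2 <= (C * `|x|) ^+ 2.
  by rewrite ler_pXn2r ?nnegrE// mulr_ge0.
rewrite exprMn => /le_trans; apply.
by rewrite ler_wpM2r ?sqr_ge0// lerDl.
Qed.

(* For [v = sum_A f_k c_k], expanding [<v, v>] along the sum and applying
   AM-GM termwise gives [2 |v|^2 <= |v|^2 + B sum_A |c_k|^2]. *)
Lemma synthesis_bound F (B : R) (c : I -> quat R) A : 0 < B ->
  (forall x A, \sum_(k <- A) qnorm (dot x (F k)) ^+ 2 <= B * `|x| ^+ 2) ->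
  `|\sum_(k <- A) rscale (F k) (c k)| ^+ 2 <=
    B * \sum_(k <- A) qnorm (c k) ^+ 2.
Proof.
move=> B0 FB; set v := \sum_(k <- A) _.
have : 2 * qre (dot v v) <=
    \sum_(k <- A) (qnorm (dot v (F k)) ^+ 2 / B + B * qnorm (c k) ^+ 2).
  rewrite {2}/v dot_sumr.
  elim: (enum_fset A) => [|k r IH]; first by rewrite !big_nil /= mulr0.
  by rewrite !big_cons mulrDr lerD// dotZr qre_mul_le.
rewrite big_split /= -mulr_suml -mulr_sumr qre_dotxx.
have : (\sum_(k <- A) qnorm (dot v (F k)) ^+ 2) / B <= `|v| ^+ 2.
  by rewrite ler_pdivrMr// mulrC.
lra.
Qed.

Lemma big_fsetD (V : zmodType) (u : I -> V) (A B : {fset I}) :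
  (B `<=` A)%fset ->
  \sum_(k <- A) u k = \sum_(k <- B) u k + \sum_(k <- (A `\` B)%fset) u k.
Proof.
move=> BA; rewrite (big_fsetID _ (mem B)) /=; congr (_ + _).
  apply: eq_fbigl => k; rewrite !inE /=.
  by case kB: (k \in B); rewrite ?andbF// (fsubsetP BA).
by apply: eq_fbigl => k; rewrite !inE andbC.
Qed.

(** Choose [A0] whose sum of [|c_k|^2] is within [e^2 / B] of the supremum. Terms outside [A0] then
    contribute less than [e^2 / B], and [synthesis_bound] turns this into a Cauchy estimate. *)
Lemma has_sum_synthesis F (c : I -> quat R) (C : R) : bessel F ->
  (forall A, \sum_(k <- A) qnorm (c k) ^+ 2 <= C) ->
  has_sum (fun k => rscale (F k) (c k)) (synthesis F c).
Proof.
move=> /besselP[B B0 FB] cC.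
suff : cauchy (partial_sum (fun k => rscale (F k) (c k)) @ totally).
  by move/cauchy_cvgP.
apply: cauchy_exP => e e0.
pose S := range (fun A => \sum_(k <- A) qnorm (c k) ^+ 2).
have supS : has_sup S.
  split; first by exists (\sum_(k <- fset0) qnorm (c k) ^+ 2), fset0.
  by exists C => _ [A _ <-].
have d0 : 0 < e ^+ 2 / B by rewrite divr_gt0// exprn_gt0.
have [_ [A0 _ <-] A0S] := sup_adherent d0 supS.
exists (partial_sum (fun k => rscale (F k) (c k)) A0), A0 => // A /= A0A.
rewrite -ball_normE /= !partial_sumE (big_fsetD _ A0A) opprD addrA subrr sub0r.
rewrite normrN -(@ltr_pXn2r _ 2) ?nnegrE ?(ltW e0)//.
rewrite (le_lt_trans (synthesis_bound _ _ B0 FB))// mulrC -ltr_pdivlMr//.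
have : \sum_(k <- A) qnorm (c k) ^+ 2 <= sup S.
  by apply: sup_upper_bound => //; exists A.
rewrite (big_fsetD _ A0A); move: A0S; lra.
Qed.

Lemma has_sum_frame_op F G x : bessel F -> bessel G ->
  has_sum (fun k => rscale (F k) (dot (G k) x)) (synthesis F (analysis G x)).
Proof.
move=> bF /besselP[B B0 GB].
apply: (@has_sum_synthesis _ _ (B * `|x| ^+ 2)) => // A.
under eq_bigr do rewrite /analysis -qnorm_conj dot_conj.
exact: GB.
Qed.

Lemma right_linear_frame_op F G : bessel F -> bessel G ->
  right_linear (fun x => synthesis F (analysis G x)).
Proof.
move=> bF bG x y p q.
apply: (has_sum_unique (has_sum_frame_op bF bG)).
have := has_sum_lin (p := p) (q := q) (has_sum_frame_op (x := x) bF bG)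
  (has_sum_frame_op (x := y) bF bG).
congr (has_sum _ _); apply/funext => k.
by rewrite dotDr !dotZr rscaleDr !rscaleA.
Qed.

(** The two expansions agree term by term in real part, so exchanging [F] and [G] gives the adjoint
    operator. *)
Lemma frame_op_adjoint F G x y : bessel F -> bessel G ->
  qre (dot (synthesis G (analysis F x)) y) =
  qre (dot x (synthesis F (analysis G y))).
Proof.
move=> bF bG; rewrite qre_dotC.
apply: (has_sum_qre_dot_eq (has_sum_frame_op (x := x) bG bF)
  (has_sum_frame_op (x := y) bF bG)) => k.
by rewrite qre_dotC dotZl dotZr dot_conj.
Qed.

Lemma Kdual_Kframe (K : H -> H) F G : right_linear K -> bounded_op K ->
  bessel F -> is_Kdual K F G -> is_Kframe K F.
Proof.
move=> lK bK bF [/besselP[B B0 GB] FGK].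
(* The lower frame bound is the inverse of the Bessel bound [B] of the dual. *)
have [C C0 FC] := bF; exists B^-1, C; split=> //; first by rewrite invr_gt0.
move=> x; rewrite FC andbT.
have [f Ff] : exists f : R, frame_sum F x = f%:E.
  exists (fine (frame_sum F x)); rewrite fineK// ge0_fin_numE.
    exact: le_lt_trans (FC x) (ltry _).
  by apply: esum_ge0 => k _; rewrite lee_fin sqr_ge0.
have fA A : \sum_(k <- A) qnorm (dot x (F k)) ^+ 2 <= f.
  by rewrite -lee_fin -Ff ge_frame_sum.
rewrite Ff lee_fin mulrC ler_pdivrMr// mulrC; set z := adjoint K x.
have zK : `|z| ^+ 2 = qre (dot x (K z)) by rewrite -qre_dotxx adjointPl.
suff : qre (dot x (K z)) <= (B * f + `|z| ^+ 2) / 2 by rewrite -zK; lra.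
apply: (has_sum_qre_dot_le (FGK z)) => A.
(* AM-GM with weight [1 / B]: the [G] part is then at most [|z|^2], half of the left-hand limit
   [2 |z|^2], and can be absorbed. *)
have : \sum_(k <- A) 2 * qre (dot x (rscale (F k) (dot (G k) z))) <=
    \sum_(k <- A) (qnorm (dot x (F k)) ^+ 2 / B^-1 +
      B^-1 * qnorm (dot z (G k)) ^+ 2).
  apply: ler_sum => k _; rewrite dotZr -(qnorm_conj (dot z _)) dot_conj.
  by apply: qre_mul_le; rewrite invr_gt0.
rewrite big_split /= -mulr_suml -!mulr_sumr invrK.
have : B^-1 * \sum_(k <- A) qnorm (dot z (G k)) ^+ 2 <= `|z| ^+ 2.
  by rewrite mulrC ler_pdivrMr// mulrC.
have : (\sum_(k <- A) qnorm (dot x (F k)) ^+ 2) * B <= B * f.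
  by rewrite mulrC ler_pM2l.
lra.
Qed.

Lemma Kframe_bessel (K : H -> H) F : is_Kframe K F -> bessel F.
Proof. by case=> A [B [_ B0 FB]]; exists B => // x; case/andP: (FB x). Qed.

End BesselSequences.

(** * The operator Psi *)

Section ApproximateDual.
Variables (R : realType) (H : quatHilbertType R) (I : countType).
Variables (K : H -> H) (F G : I -> H).
Hypotheses (lK : right_linear K) (bK : bounded_op K) (clK : closed (range K)).
Hypothesis Kd1 : opnorm (pseudo_inverse K) = 1%E.
Hypotheses (bF : bessel F) (bG : bessel G).
Hypothesis FG1 :
  (opnorm (fun x => (K x - synthesis F (analysis G x))%R) < 1)%E.

Let M := range K.
Let P := orth_proj M.
Let Kd := pseudo_inverse K.
Let V x := synthesis F (analysis G x).

Let sM : right_subspace M := subspace_range lK.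
Let lP : right_linear P := right_linear_orth_proj sM clK.
Let bP : bounded_op P := bounded_op_orth_proj sM clK.
Let lKd : right_linear Kd := right_linear_pseudo_inverse lK bK clK.
Let lV : right_linear V := right_linear_frame_op bF bG.

(** This makes [Kd] bounded, and lets [near_id_Psi] keep the constant of [K - V], which is below
    1. *)
Lemma norm_pseudo_inverse x : `|Kd x| <= `|x|.
Proof. by rewrite -[leRHS]mul1r; apply: opnorm_le; rewrite ?Kd1. Qed.

Let bKd : bounded_op Kd.
Proof. by exists 1 => x; rewrite mul1r norm_pseudo_inverse. Qed.

Lemma right_linear_Psi : right_linear (Psi K F G).
Proof.
exact: right_linear_comp lP (right_linear_comp lV lKd).
Qed.

(* On [R(K)] one has [x - Psi x = P (K - T_F T_G^* ) K^dagger x]. *)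
Lemma near_id_Psi : exists2 c : R, c < 1 &
  forall x, M x -> `|x - Psi K F G x| <= c * `|x|.
Proof.
have lD := right_linear_sub lK lV.
have [c [c0 c1 Dc]] := opnorm_lt1 lD FG1; exists c => // x Mx.
rewrite -[X in X - _](orth_proj_id sM clK Mx).
rewrite -[X in orth_proj _ X - _](pseudo_inverseK lK bK clK Mx).
rewrite -right_linearB// (le_trans (norm_orth_proj sM clK _))//.
by rewrite (le_trans (Dc _))// ler_wpM2l// norm_pseudo_inverse.
Qed.

Lemma operator_on_Psi : operator_on M (Psi K F G).
Proof.
have [c _ Pc] := near_id_Psi; split=> [x _|x y p q _ _|].
- exact: orth_proj_in.
- exact: right_linear_Psi.
(* Here [Psi x] is written as [x - (x - Psi x)]. *)
exists (1 + c) => x Mx; rewrite -[X in `|X|](subKr x).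
rewrite (le_trans (ler_normB _ _))//.
by rewrite mulrDl mul1r lerD2l Pc.
Qed.

Lemma inverse_on_Psi : exists S, inverse_on M (Psi K F G) S.
Proof.
have [c c1 Pc] := near_id_Psi.
exact: (near_id_inverse sM clK operator_on_Psi c1 Pc).
Qed.

(** * The two dual pairs obtained from an inverse of [Psi] *)

Section Inverse.
Variable S : H -> H.
Hypothesis SPsi : inverse_on M (Psi K F G) S.

(** [S] is controlled only on [R(K)]; composing with [P] gives a bounded right linear operator on
    the whole space, which has an adjoint. *)
Let L x := S (P x).

Let lL : right_linear L.
Proof.
case: SPsi => -[_ lS _] _ x y p q; rewrite /L lP lS//; exact: orth_proj_in.
Qed.

Let bL : bounded_op L.
Proof.
case: SPsi => -[_ _ [C SC]] _; have C0 : 0 <= `|C| by [].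
exists `|C| => x; rewrite (le_trans (SC _ _))//; first exact: orth_proj_in.
rewrite (@le_trans _ _ (`|C| * `|P x|))//.
  by rewrite ler_wpM2r// ler_norm.
by rewrite ler_wpM2l// norm_orth_proj.
Qed.

(** As [Kd] vanishes on the complement of [R(K)], [x] may be replaced by [P x] inside it, and there
    [S] inverts [P V Kd]. *)
Let LVKd x : L (V (Kd x)) = P x.
Proof.
case: SPsi => _ SP; rewrite /Kd -pseudo_inverse_orth_proj//.
exact: (SP _ (orth_proj_in sM clK x)).1.
Qed.

Lemma Kdual_left : is_Kdual K (L \o F)
  (fun k => adjoint K (adjoint (pseudo_inverse K) (G k))).
Proof.
have dotG x k : dot (adjoint K (adjoint (pseudo_inverse K) (G k))) x =
    dot (G k) (Kd (K x)) by rewrite !adjointPl.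
split=> [|x].
  apply: (bessel_map bG (bounded_op_comp bKd bK)) => x k.
  by rewrite -dot_conj dotG dot_conj.
have := has_sum_map lL bL (has_sum_frame_op (x := Kd (K x)) bF bG).
rewrite LVKd /P orth_proj_id//; last by exists x.
congr (has_sum _ _); apply/funext => k.
by rewrite /= right_linearZ// dotG.
Qed.

Lemma Kdual_right : is_Kdual K (fun k => adjoint (pseudo_inverse K) (G k))
  (fun k => adjoint K (L (F k))).
Proof.
have dotF x k : dot (adjoint K (L (F k))) x = dot (F k) (adjoint L (K x)).
  by rewrite adjointPl// adjointP.
split=> [|x].
  apply: (bessel_map bF (bounded_op_comp (bounded_op_adjoint lL bL) bK)).
  by move=> x k; rewrite -dot_conj dotF dot_conj.
have lKd' := right_linear_adjoint lKd bKd.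
have := has_sum_map lKd' (bounded_op_adjoint lKd bKd)
  (has_sum_frame_op (x := adjoint L (K x)) bG bF).
(* Moving all operators to the other side, the pairing with [z] becomes
   [<K x, L V Kd z> = <K x, P z> = <K x, z>] in real part. *)
have -> : adjoint Kd (synthesis G (analysis F (adjoint L (K x)))) = K x.
  apply: qre_dot_ext => z; rewrite adjointPl// frame_op_adjoint//.
  by rewrite adjointPl// LVKd /P dot_orth_proj//; exists x.
congr (has_sum _ _); apply/funext => k.
by rewrite /= right_linearZ// dotF.
Qed.

Lemma bessel_left : bessel (L \o F).
Proof.
apply: (bessel_map bF (bounded_op_adjoint lL bL)) => x k.
by rewrite /= adjointPl.
Qed.

Lemma bessel_right : bessel (fun k => adjoint (pseudo_inverse K) (G k)).
Proof. by apply: (bessel_map bG bKd) => x k; rewrite adjointP. Qed.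

End Inverse.

End ApproximateDual.

(** An inverse on [R(K)] is determined only there, so the last clause is stated for every function
    that restricts to it. *)
Theorem theorem4p3 (R : realType) (H : quatHilbertType R) (I : countType)
    (K : H -> H) (F G : I -> H) :
  separable_space H ->
  right_linear K -> bounded_op K -> closed (range K) -> opnorm (pseudo_inverse K) = 1%E ->
  is_Kframe K F -> is_approx_Kdual K F G ->
  [/\ operator_on (range K) (Psi K F G),
      exists Psi_inv : H -> H, inverse_on (range K) (Psi K F G) Psi_inv
    & forall Psi_inv : H -> H, inverse_on (range K) (Psi K F G) Psi_inv ->
      let F1 := fun k => Psi_inv (orth_proj (range K) (F k)) in
      let G1 := fun k => adjoint (pseudo_inverse K) (G k) in
      (is_Kframe K F1 /\ is_Kdual K F1 (fun k => adjoint K (G1 k))) /\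
      (is_Kframe K G1 /\ is_Kdual K G1 (fun k => adjoint K (F1 k)))].
Proof.
move=> _ lK bK clK Kd1 /Kframe_bessel bF [bG FG1]; split.
- exact: operator_on_Psi.
- exact: inverse_on_Psi.
move=> S SPsi F1 G1.
have dF := Kdual_left lK bK clK Kd1 bF bG SPsi.
have dG := Kdual_right lK bK clK Kd1 bF bG SPsi.
split; split=> //.
  apply: (Kdual_Kframe lK bK _ dF); exact: bessel_left SPsi.
apply: (Kdual_Kframe lK bK _ dG); exact: bessel_right.
Qed.
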